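(* Let $A\in\mathbb{R}^{m\times n}$ with $m\ge n$ and $b\in\mathbb{R}^m$, and consider the mixed precision variant of LSQR described in the context: the Lanczos bidiagonalization with full reorthogonalization (LBFRO) is carried out with roundoff unit $\mathbf{u}$, the Givens QR factorization is performed in double precision, and the vectors $x_k,w_{k+1}$ are updated in arithmetic with roundoff unit $\bar{\mathbf{u}}$, giving computed vectors $\hat x_k,\hat w_{k+1}$. Denote by $x_k$ the solution obtained when the Givens QR factorization is performed in double precision and all other computations of the updating procedure are exact. Then at each iteration $k$, $$\frac{\|\hat x_k-x_k\|}{\|x_k\|}\le\sqrt{k}\,\bigl[1+(2+2\sqrt{k}+k)\,\kappa(\widehat R_k)\bigr]\bar{\mathbf{u}}+\mathcal{O}(\bar{\mathbf{u}}^2+\bar{\mathbf{u}}\mathbf{u}),$$ where $\kappa(\widehat R_k)=\|\widehat R_k\|\,\|\widehat R_k^{-1}\|$ and $\widehat R_k\in\mathbb{R}^{k\times k}$ is the unit upper bidiagonal matrix with superdiagonal entries $\theta_2/\rho_1,\theta_3/\rho_2,\dots,\theta_k/\rho_{k-1}$.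
   Context: Notation: $\|\cdot\|$ is the vector or matrix 2-norm. $|\cdot|$ applied to a vector or matrix is the entrywise absolute value, and $\le$ between such objects is entrywise. $\mathcal{O}(\cdot)$ is understood as $\mathbf{u},\bar{\mathbf{u}}\to0$; the hidden constants may depend on $k$, on the problem data and on $\widehat R_k$, but not otherwise on $\mathbf{u},\bar{\mathbf{u}}$. LBFRO. Lanczos bidiagonalization of $A$ with starting vector $b$ is the recursion: $\beta_1=\|b\|$, $p_1=b/\beta_1$, $\alpha_1=\|A^Tp_1\|$, $q_1=A^Tp_1/\alpha_1$, and for $j\ge1$: $s_j=Aq_j-\alpha_jp_j$, $\beta_{j+1}=\|s_j\|$, $p_{j+1}=s_j/\beta_{j+1}$, $r_j=A^Tp_{j+1}-\beta_{j+1}q_j$, $\alpha_{j+1}=\|r_j\|$, $q_{j+1}=r_j/\alpha_{j+1}$. In LBFRO every new $p_j$ and $q_j$ is reorthogonalized against all previous ones. The symbols $\alpha_i,\beta_i,q_i$, $Q_k=(q_1,\dots,q_k)$ denote the quantities computed in floating point arithmetic with roundoff unit $\mathbf{u}$. It is assumed that the iteration does not terminate (all $\alpha_i,\beta_i\neq0$). A known property of LBFRO (recalled from earlier work, may be used): there is a matrix $\bar Q_k\in\mathbb{R}^{n\times k}$ with orthonormal columns such that $\|Q_k-\bar Q_k\|=\mathcal{O}(\mathbf{u})$. Updating procedure. Start from $x_0=\mathbf{0}$, $w_1=q_1$, $\bar\phi_1=\beta_1$, $\bar\rho_1=\alpha_1$. For $i=1,2,\dots$: (Givens QR part, scalars)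 $\rho_i=(\bar\rho_i^2+\beta_{i+1}^2)^{1/2}$, $c_i=\bar\rho_i/\rho_i$, $s_i=\beta_{i+1}/\rho_i$, $\theta_{i+1}=s_i\alpha_{i+1}$, $\bar\rho_{i+1}=-c_i\alpha_{i+1}$, $\phi_i=c_i\bar\phi_i$, $\bar\phi_{i+1}=s_i\bar\phi_i$; (vector part) $x_i=x_{i-1}+(\phi_i/\rho_i)w_i$, $w_{i+1}=q_{i+1}-(\theta_{i+1}/\rho_i)w_i$. Throughout, $\rho_i,\theta_{i+1},\phi_i$ denote the values computed in double precision; they are used as given real numbers in both the exact and the rounded vector updates. Set $D_k=\mathrm{diag}(\rho_1,\dots,\rho_k)$, $f_k=(\phi_1,\dots,\phi_k)^T$, $R_k=D_k\widehat R_k$, $W_k=(w_1,\dots,w_k)=Q_k\widehat R_k^{-1}$. With the vector part done exactly, $x_k=W_kD_k^{-1}f_k=Q_kR_k^{-1}f_k$. Rounded vector updates. $\hat x_k,\hat w_k$ denote the vectors computed when the vector part is performed in floating point arithmetic with roundoff unit $\bar{\mathbf{u}}$, under the model $\mathrm{fl}(a\ \mathrm{op}\ b)=(a\ \mathrm{op}\ b)(1+\epsilon)$, $|\epsilon|\le\bar{\mathbf{u}}$, $\mathrm{op}\in\{+,-,*,/\}$, with its standard consequences: for vectors $u,v$ and a scalar $\alpha$, $\mathrm{fl}(u+\alpha v)=u+\alpha v+w$ with $|w|\le(|u|+2|\alpha v|)\bar{\mathbf{u}}+\mathcal{O}(\bar{\mathbf{u}}^2)$; and for a product of matrices $M\in\mathbb{R}^{m'\times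 n'}$ and $N\in\mathbb{R}^{n'\times l'}$ (including outer-product based evaluation), $\mathrm{fl}(MN)=MN+X$ with $|X|\le n'|M||N|\bar{\mathbf{u}}+\mathcal{O}(\bar{\mathbf{u}}^2)$. Thus $\hat w_1=\mathrm{fl}(q_1)$ (with error of norm at most $\|q_1\|\bar{\mathbf{u}}+\mathcal{O}(\bar{\mathbf{u}}^2)$), $\hat w_{i+1}=\mathrm{fl}(q_{i+1}-(\theta_{i+1}/\rho_i)\hat w_i)$, and $\hat x_k$ is the outer-product based floating point evaluation of $\widehat W_k(D_k^{-1}f_k)$ with $\widehat W_k=(\hat w_1,\dots,\hat w_k)$, i.e. the floating point evaluation of $\hat x_i=\hat x_{i-1}+(\phi_i/\rho_i)\hat w_i$, $\hat x_0=\mathbf{0}$. The computed Lanczos vectors are normalized, $\|q_i\|=1$ (up to $\mathcal{O}(\mathbf{u})$). *)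

(* Defs.v *)
From HB Require Import structures.
From mathcomp Require Import all_boot all_order all_algebra.
From mathcomp Require Import classical_sets reals.

Set Implicit Arguments.
Unset Strict Implicit.
Unset Printing Implicit Defensive.

Import Order.TTheory GRing.Theory Num.Theory.
Local Open Scope ring_scope.

(* All sequences (alpha, beta, p, q, rho, theta, phi, w) are indexed from 1, as
   is usual for Lanczos bidiagonalization; only x_0 uses index 0.  The columns
   of the matrices built from them are numbered from 0, so that column j of
   Q_k is q_(j+1). *)

Section Norms.
Variable R : realType.

Definition norm2 n (v : 'cV[R]_n) : R := Num.sqrt (\sum_i v i 0 ^+ 2).

(* The operator norm induced by norm2; the norm on matrices provided by
   MathComp-Analysis is the entrywise sup norm. *)
Definition mxnorm2 m n (M : 'M[R]_(m, n)) : R :=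
  sup [set norm2 (M *m x) | x in [set x : 'cV[R]_n | norm2 x <= 1]]%classic.

Definition cond2 n (M : 'M[R]_n) : R := mxnorm2 M * mxnorm2 (invmx M).

End Norms.

Section Lanczos.
Variables (R : realType) (m n : nat) (A : 'M[R]_(m, n)) (b : 'cV[R]_m).

(* k steps of Lanczos bidiagonalization of A with starting vector b and full
   reorthogonalization, in finite precision.  s_0 = b, and r_0 stands for
   A^T p_1; for j >= 1, s_j and r_j are the vectors of the recursion, after
   reorthogonalization against p_1, ..., p_j and q_1, ..., q_j.
   Every computed quantity agrees with the formula defining it, evaluated at
   the previously computed quantities, up to an error governed by e.  With
   e = c * u this is satisfied in floating point arithmetic with roundoff unit u
   whatever the order of summation and the variant of Gram-Schmidt, for a
   constant c depending on these, on k and on the data. *)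
Definition LBFRO (k : nat) (e : R) (alpha beta : nat -> R)
    (p : nat -> 'cV[R]_m) (q : nat -> 'cV[R]_n) : Prop :=
  exists (s : nat -> 'cV[R]_m) (r : nat -> 'cV[R]_n),
  [/\ s 0%N = b,
      norm2 (r 0%N - A^T *m p 1%N) <= e,
      (forall j : nat, (0 < j <= k)%N ->
         let v := A *m q j - alpha j *: p j in
         norm2 (s j - (v - \sum_(1 <= l < j.+1) p l *m ((p l)^T *m v))) <= e),
      (forall j : nat, (0 < j < k)%N ->
         let v := A^T *m p j.+1 - beta j.+1 *: q j in
         norm2 (r j - (v - \sum_(1 <= l < j.+1) q l *m ((q l)^T *m v))) <= e)
    & (forall j : nat, (j <= k)%N ->
         `|beta j.+1 - norm2 (s j)| <= e * norm2 (s j) /\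
         norm2 (p j.+1 - (beta j.+1)^-1 *: s j) <= e) /\
      (forall j : nat, (j < k)%N ->
         `|alpha j.+1 - norm2 (r j)| <= e * norm2 (r j) /\
         norm2 (q j.+1 - (alpha j.+1)^-1 *: r j) <= e)].

Definition nonterminating (k : nat) (alpha beta : nat -> R) : Prop :=
  (forall i : nat, (0 < i <= k)%N -> alpha i != 0) /\
  (forall i : nat, (0 < i <= k.+1)%N -> beta i != 0).

Definition Qmx (k : nat) (q : nat -> 'cV[R]_n) : 'M[R]_(n, k) :=
  \matrix_(i, j) q j.+1 i 0.

Definition near_orthonormal (k : nat) (e : R) (q : nat -> 'cV[R]_n) : Prop :=
  exists2 Qbar : 'M[R]_(n, k),
    Qbar^T *m Qbar = 1%:M & mxnorm2 (Qmx k q - Qbar) <= e.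

Definition normalized (k : nat) (e : R) (q : nat -> 'cV[R]_n) : Prop :=
  forall i : nat, (0 < i <= k)%N -> `|norm2 (q i) - 1| <= e.

End Lanczos.

Section Updates.
Variable R : realType.

(* y is a floating point approximation of x with roundoff unit eps. *)
Definition fl (eps x y : R) : Prop :=
  exists2 d : R, `|d| <= eps & y = x * (1 + d).

(* The roundoff unit of IEEE double precision. *)
Definition udouble : R := 2 ^- 53.

(* Scalars rho_1..rho_k, theta_2..theta_k, phi_1..phi_k of the Givens QR
   factorization, each arithmetic operation being done in double precision. *)
Definition givens_double (k : nat) (alpha beta rho theta phi : nat -> R)
    : Prop :=
  exists c s rhobar phibar : nat -> R,
  [/\ rhobar 1%N = alpha 1%N,
      phibar 1%N = beta 1%N,
      (forall i : nat, (0 < i <= k)%N ->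
         (exists a b t : R,
            [/\ fl udouble (rhobar i ^+ 2) a,
                fl udouble (beta i.+1 ^+ 2) b,
                fl udouble (a + b) t
              & fl udouble (Num.sqrt t) (rho i)]) /\
         [/\ fl udouble (rhobar i / rho i) (c i),
             fl udouble (beta i.+1 / rho i) (s i),
             fl udouble (c i * phibar i) (phi i)
           & fl udouble (s i * phibar i) (phibar i.+1)])
    & (forall i : nat, (0 < i < k)%N ->
         fl udouble (s i * alpha i.+1) (theta i.+1) /\
         fl udouble (- c i * alpha i.+1) (rhobar i.+1))].

Definition Rhat_mx (k : nat) (rho theta : nat -> R) : 'M[R]_k :=
  \matrix_(i, j) (if j == i then 1
                  else if j == i.+1 :> nat then theta i.+2 / rho i.+1
                  else 0).

Variable n : nat.

(* The value 0 at index 0 is conventional: it gives w_1 = q_1. *)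
Fixpoint w_exact (rho theta : nat -> R) (q : nat -> 'cV[R]_n) (i : nat)
    : 'cV[R]_n :=
  if i is j.+1
  then q j.+1 - (theta j.+1 / rho j) *: w_exact rho theta q j
  else 0.

Fixpoint x_exact (rho theta phi : nat -> R) (q : nat -> 'cV[R]_n) (i : nat)
    : 'cV[R]_n :=
  if i is j.+1
  then x_exact rho theta phi q j
       + (phi j.+1 / rho j.+1) *: w_exact rho theta q j.+1
  else 0.

(* y is a floating point evaluation of u + (num / den) * v.  The quotient t may
   be rounded too (once, not entrywise); an exactly known scalar coefficient is
   the case of a zero rounding error in t. *)
Definition fl_axpy (eps : R) (u : 'cV[R]_n) (num den : R) (v y : 'cV[R]_n)
    : Prop :=
  exists2 t : R, fl eps (num / den) t &
    forall l : 'I_n, exists2 z : R,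
      fl eps (t * v l 0) z & fl eps (u l 0 + z) (y l 0).

Definition rounded_updates (k : nat) (eps : R) (rho theta phi : nat -> R)
    (q what xhat : nat -> 'cV[R]_n) : Prop :=
  [/\ forall l : 'I_n, fl eps (q 1%N l 0) (what 1%N l 0),
      (forall i : nat, (0 < i < k)%N ->
         fl_axpy eps (q i.+1) (- theta i.+1) (rho i) (what i) (what i.+1)),
      xhat 0%N = 0
    & (forall i : nat, (i < k)%N ->
         fl_axpy eps (xhat i) (phi i.+1) (rho i.+1) (what i.+1) (xhat i.+1))].

End Updates.

(* Main.v *)
Require Import Defs.
From HB Require Import structures.
From mathcomp Require Import all_boot all_order all_algebra.
From mathcomp Require Import classical_sets reals.
From mathcomp Require Import ring lra.

Set Implicit Arguments.
Unset Strict Implicit.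
Unset Printing Implicit Defensive.

Import Order.TTheory GRing.Theory Num.Theory.
Local Open Scope ring_scope.

(** Write [Q], [W] and [What] for the matrices with columns [q_j], [w_j] and
    [what_j], let [y] have entries [phi_j / rho_j], and put [g = Rhat^-1 y].
    The recurrence for [w] says [W Rhat = Q] ([w_exact_Rhat]), so the exact
    iterate is [W y = Q g], and [norm2 g] is [norm2 (Q g)] up to a factor
    [1 + O(u)] because [Q] is close to a matrix with orthonormal columns.  Two
    errors separate the computed iterate from it.

    - The rounded recurrence gives [What Rhat = Q + E], hence
      [What y - W y = E g].  Column [j] of [E] is the local error of one update,
      of norm at most [ubar] for the rounding of [q_j], plus, from the second
      column on, [3 ubar |theta_j / rho_(j-1)| norm2 what_(j-1)] ([col_E_le]).
    - Accumulating [What y] adds a vector [X], every term [y_j what_j] having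
      undergone at most [k + 2] roundings ([fl_linear_comb]).

    Bars around a matrix denote its operator norm [mxnorm2] below.  As
    [What = (Q + E) Rhat^-1], the columns of [What] have norm at most
    [(1 + O(u) + |E|) |Rhat^-1|] ([what_le]), while the entries of [Rhat] are
    bounded by its norm and [norm2 y <= |Rhat| norm2 g] ([xhat_err]).  The
    relative error is therefore, to first order in [ubar], at most
    [sqrt k + (3 sqrt (k-1) + (k+2) sqrt k) kappa], and
    [3 sqrt (k-1) <= 2k] brings this below the announced constant
    ([sqrt_count_le]).  The same bound on [What] makes [E_le] an inequality with
    [|E|] on both sides; its right-hand side has the factor [ubar], so for small
    [ubar] it yields [|E| = O(ubar)] without following the recurrence step by
    step.  The constants and second-order terms are collected in
    [first_order_bound]. *)

(** * Euclidean and operator norms *)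

Section Norms.
Variable R : realType.

Lemma cauchy_schwarz (I : finType) (a b : I -> R) :
  \sum_i a i * b i
    <= Num.sqrt (\sum_i a i ^+ 2) * Num.sqrt (\sum_i b i ^+ 2).
Proof.
set A := \sum_i a i ^+ 2; set B := \sum_i b i ^+ 2; set S := \sum_i _.
have A0 : 0 <= A by apply: sumr_ge0 => i _; rewrite sqr_ge0.
rewrite -sqrtrM //; apply: (le_trans (ler_norm _)).
rewrite -sqrtr_sqr ler_wsqrtr //.
have : 0 <= \sum_i \sum_j (a i * b j - a j * b i) ^+ 2.
  by apply: sumr_ge0 => i _; apply: sumr_ge0 => j _; rewrite sqr_ge0.
(* Lagrange's identity *)
have -> : \sum_i \sum_j (a i * b j - a j * b i) ^+ 2 = 2 * (A * B - S ^+ 2).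
  have -> : 2 * (A * B - S ^+ 2) = A * B - 2 * (S * S) + B * A by ring.
  rewrite /A /B /S !big_distrlr mulr_sumr -sumrB -big_split /=.
  apply: eq_bigr => i _; rewrite mulr_sumr -sumrB -big_split /=.
  by apply: eq_bigr => j _; ring.
by lra.
Qed.

Lemma norm2_ge0 n (v : 'cV[R]_n) : 0 <= norm2 v.
Proof. exact: sqrtr_ge0. Qed.

Lemma norm2_sqr n (v : 'cV[R]_n) : norm2 v ^+ 2 = \sum_i v i 0 ^+ 2.
Proof. by rewrite sqr_sqrtr //; apply: sumr_ge0 => i _; rewrite sqr_ge0. Qed.

Lemma norm20 n : norm2 (0 : 'cV[R]_n) = 0.
Proof.
by rewrite /norm2 big1 ?sqrtr0 // => i _; rewrite mxE expr0n.
Qed.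

Lemma norm2_le_abs n (u v : 'cV[R]_n) :
  (forall i, `|u i 0| <= `|v i 0|) -> norm2 u <= norm2 v.
Proof.
move=> uv; rewrite ler_wsqrtr //; apply: ler_sum => i _.
by rewrite -[u i 0 ^+ 2]real_normK ?num_real // -[v i 0 ^+ 2]real_normK
  ?num_real // lerXn2r ?nnegrE.
Qed.

Lemma norm2_triangle n (u v : 'cV[R]_n) : norm2 (u + v) <= norm2 u + norm2 v.
Proof.
rewrite -(@ler_pXn2r _ 2) ?nnegrE ?addr_ge0 ?norm2_ge0 //.
rewrite sqrrD !norm2_sqr.
have -> : \sum_i (u + v) i 0 ^+ 2 = \sum_i u i 0 ^+ 2
    + (\sum_i u i 0 * v i 0) *+ 2 + \sum_i v i 0 ^+ 2.
  by rewrite -sumrMnl -!big_split /=; apply: eq_bigr => i _; rewrite mxE sqrrD.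
by rewrite lerD2r lerD2l lerMn2r /= cauchy_schwarz.
Qed.

Lemma norm2Z n (a : R) (v : 'cV[R]_n) : norm2 (a *: v) = `|a| * norm2 v.
Proof.
rewrite /norm2 -sqrtr_sqr -sqrtrM ?sqr_ge0 // mulr_sumr; congr Num.sqrt.
by apply: eq_bigr => i _; rewrite mxE exprMn.
Qed.

Lemma norm2_sum n (I : finType) (F : I -> 'cV[R]_n) :
  norm2 (\sum_i F i) <= \sum_i norm2 (F i).
Proof.
apply: (big_ind2 (fun x y => norm2 x <= y)) => [|x a y b xa yb|//].
  by rewrite norm20.
by rewrite (le_trans (norm2_triangle _ _)) // lerD.
Qed.

Lemma norm2_isometry m n (M : 'M[R]_(m, n)) (v : 'cV[R]_n) :
  M^T *m M = 1%:M -> norm2 (M *m v) = norm2 v.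
Proof.
move=> MM.
have dotE p (w : 'cV[R]_p) : \sum_i w i 0 ^+ 2 = (w^T *m w) 0 0.
  by rewrite mxE; apply: eq_bigr => i _; rewrite mxE expr2.
by rewrite /norm2 !dotE trmx_mul mulmxA -(mulmxA _ _ M) MM mulmx1.
Qed.

Lemma mulmx_sum_col m n (M : 'M[R]_(m, n)) (v : 'cV[R]_n) :
  M *m v = \sum_j v j 0 *: col j M.
Proof.
apply/colP => i; rewrite mxE summxE; apply: eq_bigr => j _.
by rewrite !mxE mulrC.
Qed.

Lemma sum_abs_le n (v : 'cV[R]_n) (B : 'I_n -> bool) :
  \sum_(j | B j) `|v j 0| <= Num.sqrt #|B|%:R * norm2 v.
Proof.
have -> : \sum_(j | B j) `|v j 0| = \sum_j (B j)%:R * `|v j 0|.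
  rewrite big_mkcond /=; apply: eq_bigr => j _.
  by case: (B j); rewrite ?mul1r ?mul0r.
apply: (le_trans (cauchy_schwarz _ _)); rewrite /norm2.
have -> : \sum_j ((B j)%:R : R) ^+ 2 = #|B|%:R.
  rewrite -sum1_card natr_sum [RHS]big_mkcond /=; apply: eq_bigr => j _.
  by rewrite unfold_in; case: (B j); rewrite ?expr1n ?expr0n.
by under [X in _ * Num.sqrt X]eq_bigr do rewrite real_normK ?num_real //.
Qed.

(** Cauchy-Schwarz is applied separately to the part of the column bound that
    is common to all columns and to the part that only concerns [J], so that the
    latter costs [sqrt #|J|] instead of [sqrt n]. *)
Lemma norm2_mulmx_col_split m n (M : 'M[R]_(m, n)) (v : 'cV[R]_n)
    (J : pred 'I_n) (a b : R) :
  0 <= a -> 0 <= b ->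
  (forall j, norm2 (col j M) <= a + (if J j then b else 0)) ->
  norm2 (M *m v) <= (Num.sqrt n%:R * a + Num.sqrt #|J|%:R * b) * norm2 v.
Proof.
move=> a0 b0 Mab; rewrite mulmx_sum_col; apply: (le_trans (norm2_sum _)).
apply: (@le_trans _ _ ((\sum_j `|v j 0|) * a + (\sum_(j | J j) `|v j 0|) * b)).
  rewrite !mulr_suml [X in _ <= _ + X]big_mkcond -big_split /=.
  apply: ler_sum => j _; rewrite norm2Z.
  apply: (le_trans (ler_wpM2l (normr_ge0 _) (Mab j))).
  by rewrite mulrDr; case: (J j); rewrite ?mulr0.
rewrite mulrDl (mulrAC _ a) (mulrAC _ b).
apply: lerD; apply: ler_wpM2r => //; last exact: sum_abs_le.
by have := sum_abs_le v xpredT; rewrite cardT size_enum_ord.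
Qed.

Lemma norm2_mulmx_col m n (M : 'M[R]_(m, n)) (v : 'cV[R]_n) (a : R) :
  0 <= a -> (forall j, norm2 (col j M) <= a) ->
  norm2 (M *m v) <= Num.sqrt n%:R * a * norm2 v.
Proof.
move=> a0 Ma.
have -> : Num.sqrt n%:R * a
    = Num.sqrt n%:R * a + Num.sqrt #|(pred0 : pred 'I_n)|%:R * 0.
  by rewrite mulr0 addr0.
by apply: norm2_mulmx_col_split => // j; rewrite addr0.
Qed.

Local Notation mxnorm2_set M :=
  [set norm2 (M *m x) | x in [set x : 'cV[R]__ | norm2 x <= 1]]%classic.

(** The supremum defining [mxnorm2] is only meaningful because of this bound,
    which follows from the sum of the norms of the columns. *)
Lemma mxnorm2_has_ubound m n (M : 'M[R]_(m, n)) : has_ubound (mxnorm2_set M).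
Proof.
set B := \sum_j norm2 (col j M).
have B0 : 0 <= B by apply: sumr_ge0 => j _; exact: norm2_ge0.
exists (Num.sqrt n%:R * B) => _ [x /= x1 <-].
apply: (le_trans (norm2_mulmx_col x B0 _)) => [j|].
  rewrite /B (bigD1 j) //= lerDl.
  by apply: sumr_ge0 => i _; exact: norm2_ge0.
by rewrite ler_piMr // mulr_ge0 ?sqrtr_ge0.
Qed.

Lemma mxnorm2_ge0 m n (M : 'M[R]_(m, n)) : 0 <= mxnorm2 M.
Proof.
apply: (ub_le_sup (mxnorm2_has_ubound M)).
by exists 0; rewrite /= ?mulmx0 norm20.
Qed.

Lemma entry_le_norm2 n (v : 'cV[R]_n) (i : 'I_n) : `|v i 0| <= norm2 v.
Proof.
rewrite -sqrtr_sqr ler_wsqrtr // (bigD1 i) //= lerDl.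
by apply: sumr_ge0 => j _; rewrite sqr_ge0.
Qed.

Lemma norm2_mulmx m n (M : 'M[R]_(m, n)) (v : 'cV[R]_n) :
  norm2 (M *m v) <= mxnorm2 M * norm2 v.
Proof.
have [v0|v0] := eqVneq (norm2 v) 0.
  have -> : v = 0.
    apply/colP => i; rewrite mxE; apply/eqP.
    by rewrite -normr_le0 -v0 entry_le_norm2.
  by rewrite mulmx0 !norm20 mulr0.
have vp : 0 < norm2 v by rewrite lt_def v0 norm2_ge0.
rewrite -ler_pdivrMr // mulrC -[_^-1]ger0_norm ?invr_ge0 ?norm2_ge0 //.
rewrite -norm2Z scalemxAr; apply: (ub_le_sup (mxnorm2_has_ubound M)).
exists ((norm2 v)^-1 *: v) => //=.
by rewrite norm2Z ger0_norm ?invr_ge0 ?norm2_ge0 // mulVf.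
Qed.

Lemma mxnorm2_le m n (M : 'M[R]_(m, n)) (B : R) :
  0 <= B -> (forall v, norm2 (M *m v) <= B * norm2 v) -> mxnorm2 M <= B.
Proof.
move=> B0 MB; apply: ge_sup => [|_ [x /= x1 <-]].
  by exists (norm2 (M *m 0)), 0; rewrite //= norm20.
by apply: (le_trans (MB x)); rewrite ler_piMr.
Qed.

Lemma norm2_delta n (j : 'I_n) : norm2 (delta_mx j 0 : 'cV[R]_n) = 1.
Proof.
rewrite /norm2 (bigD1 j) //= big1 => [|i ij]; last first.
  by rewrite mxE (negPf ij) expr0n.
by rewrite mxE !eqxx expr1n addr0 sqrtr1.
Qed.

Lemma norm2_col_le m n (M : 'M[R]_(m, n)) (j : 'I_n) :
  norm2 (col j M) <= mxnorm2 M.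
Proof. by rewrite colE -[leRHS]mulr1 -(norm2_delta j) norm2_mulmx. Qed.

Lemma entry_le_mxnorm2 m n (M : 'M[R]_(m, n)) i j : `|M i j| <= mxnorm2 M.
Proof.
apply: le_trans (norm2_col_le M j).
by have := entry_le_norm2 (col j M) i; rewrite mxE.
Qed.

Lemma norm2_abs n (v : 'cV[R]_n) : norm2 (map_mx Num.norm v) = norm2 v.
Proof.
rewrite /norm2; congr Num.sqrt; apply: eq_bigr => i _.
by rewrite mxE real_normK ?num_real.
Qed.

Lemma norm2_le_abs_comb n (u v w : 'cV[R]_n) (a b : R) :
  0 <= a -> 0 <= b ->
  (forall i, `|u i 0| <= a * `|v i 0| + b * `|w i 0|) ->
  norm2 u <= a * norm2 v + b * norm2 w.
Proof.
move=> a0 b0 uvw.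
apply: (@le_trans _ _
  (norm2 (a *: map_mx Num.norm v + b *: map_mx Num.norm w))).
  apply: norm2_le_abs => i; rewrite !mxE; apply: (le_trans (uvw i)).
  exact: ler_norm.
by rewrite (le_trans (norm2_triangle _ _)) // !norm2Z !norm2_abs !ger0_norm.
Qed.

(** This turns the entrywise bounds [|u| <= g |M| |v|] of rounding error
    analysis into a norm bound; the absolute values do not change the norms of
    the columns of [M]. *)
Lemma norm2_le_abs_mulmx m n (u : 'cV[R]_m) (M : 'M[R]_(m, n)) (v : 'cV[R]_n)
    (g a : R) :
  0 <= g -> 0 <= a ->
  (forall i, `|u i 0| <= g * \sum_j `|v j 0 * M i j|) ->
  (forall j, norm2 (col j M) <= a) ->
  norm2 u <= g * (Num.sqrt n%:R * a * norm2 v).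
Proof.
move=> g0 a0 uM Ma.
apply: (@le_trans _ _
  (norm2 (g *: (map_mx Num.norm M *m map_mx Num.norm v)))).
  apply: norm2_le_abs => i; apply: (le_trans (uM i)); rewrite 2!mxE.
  apply: le_trans (ler_norm _); rewrite ler_wpM2l //.
  by apply: ler_sum => j _; rewrite !mxE normrM mulrC.
rewrite norm2Z ger0_norm // ler_wpM2l // -[norm2 v]norm2_abs.
apply: norm2_mulmx_col => // j.
have -> : col j (map_mx Num.norm M) = map_mx Num.norm (col j M).
  by apply/colP => i; rewrite !mxE.
by rewrite norm2_abs.
Qed.

End Norms.

(** * Rounding errors of the updates *)

Section Rounding.
Variable R : realType.

(** The term [num / den * v] undergoes three roundings (quotient, product, sum)
    and [u] a single one.  Keeping the exact factor [(1 + eps) ^+ 3] makes the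
    accumulation below telescope. *)
Lemma fl_axpy_entry n (eps : R) (u : 'cV[R]_n) num den (v y : 'cV[R]_n) l :
  fl_axpy eps u num den v y ->
  exists d e : R, [/\ `|d| <= eps, `|e| <= (1 + eps) ^+ 3 - 1
    & y l 0 = u l 0 * (1 + d) + num / den * v l 0 * (1 + e)].
Proof.
case=> t [d1 d1e ->] /(_ l) [z [d2 d2e ->] [d3 d3e ->]].
exists d3, ((1 + d1) * (1 + d2) * (1 + d3) - 1); split=> //; last by ring.
have -> : (1 + d1) * (1 + d2) * (1 + d3) - 1
   = d1 + d2 + d3 + (d1 * d2 + d1 * d3 + d2 * d3) + d1 * d2 * d3 by ring.
have e0 : 0 <= eps by apply: le_trans d1e.
have le2 a b : `|a| <= eps -> `|b| <= eps -> `|a * b| <= eps ^+ 2.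
  by move=> ae be; rewrite normrM expr2 ler_pM.
have le3 : `|d1 * d2 * d3| <= eps ^+ 3.
  by rewrite normrM exprSr ler_pM // le2.
have -> : (1 + eps) ^+ 3 - 1
  = eps + eps + eps + (eps ^+ 2 + eps ^+ 2 + eps ^+ 2) + eps ^+ 3 by ring.
do !(apply: (le_trans (ler_normD _ _)); apply: lerD) => //; exact: le2.
Qed.

Lemma fl_axpy_err n (eps : R) (u : 'cV[R]_n) num den (v y : 'cV[R]_n) :
  0 <= eps -> fl_axpy eps u num den v y ->
  norm2 (y - (u + (num / den) *: v))
    <= eps * norm2 u + ((1 + eps) ^+ 3 - 1) * `|num / den| * norm2 v.
Proof.
move=> e0 uy.
have g0 : 0 <= (1 + eps) ^+ 3 - 1 by rewrite subr_ge0 exprn_ege1 // lerDl.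
apply: norm2_le_abs_comb => // [|l]; first by rewrite mulr_ge0.
have [d [e [de ee yE]]] := fl_axpy_entry l uy.
have -> : (y - (u + (num / den) *: v)) l 0
    = d * u l 0 + e * (num / den) * v l 0 by rewrite !mxE yE; ring.
apply: (le_trans (ler_normD _ _)); rewrite !normrM.
by apply: lerD; do ?[apply: ler_wpM2r => //; rewrite ?mulr_ge0 //].
Qed.

Lemma fl_vector_err n (eps : R) (u y : 'cV[R]_n) :
  0 <= eps -> (forall l, fl eps (u l 0) (y l 0)) ->
  norm2 (y - u) <= eps * norm2 u.
Proof.
move=> e0 uy; rewrite -[eps in leRHS](ger0_norm e0) -norm2Z.
apply: norm2_le_abs => l.
case: (uy l) => d de yE; rewrite !mxE yE.
have -> : u l 0 * (1 + d) - u l 0 = d * u l 0 by ring.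
by rewrite !normrM (ger0_norm e0) ler_wpM2r.
Qed.

(** Each step multiplies the relative error of all earlier terms by one more
    factor [1 + eps] and brings in a term with three factors; hence the exponent
    [i + 2], largest for the first term. *)
Lemma fl_linear_comb n (k : nat) (eps : R) (num den : nat -> R)
    (v x : nat -> 'cV[R]_n) :
  0 <= eps -> x 0%N = 0 ->
  (forall i, (i < k)%N ->
     fl_axpy eps (x i) (num i.+1) (den i.+1) (v i.+1) (x i.+1)) ->
  forall i l, (i <= k)%N ->
  `|x i l 0 - \sum_(j < i) num j.+1 / den j.+1 * v j.+1 l 0|
    <= ((1 + eps) ^+ i.+2 - 1)
       * \sum_(j < i) `|num j.+1 / den j.+1 * v j.+1 l 0|.
Proof.
move=> e0 x0 step i l; elim: i => [|i IH] ik.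
  by rewrite x0 !big_ord0 mxE subr0 mulr0 normr0.
rewrite !big_ord_recr /=; move: (IH (ltnW ik)).
set S := \sum_(j < i) _; set T := \sum_(j < i) _ => {}IH.
have [d [e [de ee ->]]] := fl_axpy_entry l (step i ik).
set a := num i.+1 / den i.+1 * v i.+1 l 0.
have -> : x i l 0 * (1 + d) + a * (1 + e) - (S + a)
  = (x i l 0 - S) * (1 + d) + d * S + e * a by ring.
have ST : `|S| <= T by exact: ler_norm_sum.
have T0 : 0 <= T by apply: le_trans ST.
have d1 : `|1 + d| <= 1 + eps.
  by apply: (le_trans (ler_normD _ _)); rewrite normr1 lerD2l.
have ei : (1 + eps) ^+ 3 - 1 <= (1 + eps) ^+ i.+3 - 1.
  by rewrite lerD2r ler_weXn2l // lerDl.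
rewrite [leRHS]mulrDr; apply: (le_trans (ler_normD _ _)); apply: lerD; last first.
  by rewrite normrM ler_wpM2r // (le_trans ee).
have -> : ((1 + eps) ^+ i.+3 - 1) * T
    = ((1 + eps) ^+ i.+2 - 1) * T * (1 + eps) + eps * T.
  by rewrite [_ ^+ i.+3]exprSr; ring.
apply: (le_trans (ler_normD _ _)); rewrite !normrM; apply: lerD.
  by apply: ler_pM.
exact: ler_pM.
Qed.

Lemma expr1D_le (N : nat) : exists2 g : R, 0 <= g &
  forall x : R, 0 <= x <= 1 -> (1 + x) ^+ N - 1 <= N%:R * x + g * x ^+ 2.
Proof.
elim: N => [|N [g g0 IH]]; first by exists 0 => // x _; rewrite subrr; lra.
exists (N%:R + 2 * g) => [|x x01]; first by rewrite addr_ge0 ?mulr_ge0.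
have /andP[x0 x1] := x01; have := IH x x01; rewrite [_ ^+ N.+1]exprSr -natr1.
set p := (1 + x) ^+ N => pN.
have : (p - 1) * (1 + x) <= (N%:R * x + g * x ^+ 2) * (1 + x).
  by rewrite ler_wpM2r // addr_ge0.
have : g * x ^+ 2 * x <= g * x ^+ 2.
  by rewrite ler_piMr // mulr_ge0 // sqr_ge0.
lra.
Qed.

End Rounding.

(** * The recurrences in matrix form *)

Section MatrixForm.
Variables (R : realType) (n k : nat).
Implicit Types (rho theta phi : nat -> R) (q w : nat -> 'cV[R]_n).

Lemma col_Qmx w (j : 'I_k) : col j (Qmx k w) = w j.+1.
Proof. by apply/colP => i; rewrite !mxE. Qed.

(** [Rhat_mx] is upper triangular with unit diagonal. *)
Lemma Rhat_unit rho theta : Rhat_mx k rho theta \in unitmx.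
Proof.
rewrite -unitmx_tr unitmxE det_trig.
  by rewrite big1 ?unitr1 // => i _; rewrite !mxE eqxx.
apply/is_trig_mxP => i j ij; rewrite !mxE.
have /negPf-> : i != j by rewrite neq_ltn ij.
by rewrite ltn_eqF // ltnS ltnW.
Qed.

Lemma col_Qmx_Rhat w rho theta (j : 'I_k) :
  col j (Qmx k w *m Rhat_mx k rho theta)
    = w j.+1 + (if (0 < j)%N then (theta j.+1 / rho j) *: w j else 0).
Proof.
rewrite colE -mulmxA -colE mulmx_sum_col (bigD1 j) //= !mxE eqxx scale1r col_Qmx.
congr (_ + _); case: j => [[|j] jk] /=.
  by apply: big1 => i ij; rewrite !mxE [_ == i]eq_sym (negPf ij) scale0r.
pose i0 := Ordinal (ltnW jk).
rewrite (bigD1 i0) /=; last by rewrite -val_eqE /= ltn_eqF.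
rewrite !mxE -val_eqE /= eqxx gtn_eqF // col_Qmx /= big1 ?addr0 //.
move=> i /andP[ij ii]; rewrite !mxE [_ == i]eq_sym (negPf ij) /= eqSS.
by rewrite [_ == i :> nat]eq_sym -[_ == _]/(i == i0) (negPf ii) scale0r.
Qed.

Lemma w_exact_Rhat rho theta q :
  Qmx k (w_exact rho theta q) *m Rhat_mx k rho theta = Qmx k q.
Proof.
apply/matrixP => i j; have := congr1 (fun v : 'cV_n => v i 0)
  (col_Qmx_Rhat (w_exact rho theta q) rho theta j).
rewrite [col _ _ i 0]mxE => ->.
rewrite [Qmx k q i j]mxE; case: j => [[|j] jk] /=.
  by rewrite addr0 scaler0 subr0.
by rewrite subrK.
Qed.

Lemma x_exact_Qmx rho theta phi q :
  x_exact rho theta phi q k = Qmx k (w_exact rho theta q)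
    *m (\col_(i < k) (phi i.+1 / rho i.+1)).
Proof.
rewrite mulmx_sum_col; transitivity
  (\sum_(j < k) (phi j.+1 / rho j.+1) *: w_exact rho theta q j.+1).
  elim: k => [|i IH]; first by rewrite big_ord0.
  by rewrite big_ord_recr -IH.
by apply: eq_bigr => j _; rewrite mxE col_Qmx.
Qed.

End MatrixForm.

(** * Propagation of the rounding errors *)

Section Perturbation.
Variables (R : realType) (n k : nat) (ubar a : R).
Variables (rho theta phi : nat -> R) (q what xhat : nat -> 'cV[R]_n).
Hypotheses (ubar0 : 0 <= ubar) (a0 : 0 <= a).
Hypotheses (Qa : near_orthonormal k a q) (qa : normalized k a q).
Hypothesis (upd : rounded_updates k ubar rho theta phi q what xhat).

Let Rhat := Rhat_mx k rho theta.
Let E := Qmx k what *m Rhat - Qmx k q.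
Let y : 'cV[R]_k := \col_(i < k) (phi i.+1 / rho i.+1).
Let T := 1 + a + mxnorm2 E.

Lemma norm2_Qmx_le (v : 'cV[R]_k) : norm2 (Qmx k q *m v) <= (1 + a) * norm2 v.
Proof.
case: Qa => P PP QP; rewrite -[Qmx k q](subrK P) mulmxDl addrC mulrDl mul1r.
apply: (le_trans (norm2_triangle _ _)); rewrite norm2_isometry // lerD2l.
by apply: (le_trans (norm2_mulmx _ _)); rewrite ler_wpM2r ?norm2_ge0.
Qed.

Lemma norm2_Qmx_ge (v : 'cV[R]_k) : (1 - a) * norm2 v <= norm2 (Qmx k q *m v).
Proof.
case: Qa => P PP QP; rewrite mulrBl mul1r lerBlDr -[leLHS](norm2_isometry v PP).
have -> : P *m v = Qmx k q *m v - (Qmx k q - P) *m v.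
  by rewrite mulmxBl subKr.
apply: (le_trans (norm2_triangle _ _)); rewrite lerD2l -scaleN1r norm2Z normrN1.
rewrite mul1r; apply: (le_trans (norm2_mulmx _ _)).
by rewrite ler_wpM2r ?norm2_ge0.
Qed.

(** [what_j] is column [j] of [(Q + E) Rhat^-1]. *)
Lemma what_le (j : nat) :
  (j < k)%N -> norm2 (what j.+1) <= T * mxnorm2 (invmx Rhat).
Proof.
move=> jk; rewrite -[j]/(val (Ordinal jk)) -(@col_Qmx _ _ k).
have -> : Qmx k what = Qmx k q *m invmx Rhat + E *m invmx Rhat.
  by rewrite -mulmxDl addrC subrK mulmxK // Rhat_unit.
rewrite linearD /= !colE -!mulmxA -colE.
have N0 := norm2_ge0 (col (Ordinal jk) (invmx Rhat)).
have NR := norm2_col_le (invmx Rhat) (Ordinal jk).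
have Ta : 0 <= T by rewrite !addr_ge0 ?mxnorm2_ge0.
apply: (le_trans _ (ler_wpM2l Ta NR)).
rewrite [leRHS]mulrDl; apply: (le_trans (norm2_triangle _ _)).
by apply: lerD; [exact: norm2_Qmx_le | exact: norm2_mulmx].
Qed.

(** The first vector is only rounded, so the recurrence error is absent from
    column 0.  Elsewhere the coefficient [theta / rho] is an entry of [Rhat],
    whose norm combines with that of [Rhat^-1] from [what_le] into [cond2]. *)
Lemma col_E_le (j : 'I_k) :
  norm2 (col j E) <= ubar * (1 + a)
    + (if (0 < j)%N then ((1 + ubar) ^+ 3 - 1) * (cond2 Rhat * T) else 0).
Proof.
case: upd => w1 wS _ _.
have qj : norm2 (q j.+1) <= 1 + a.
  have := qa (i := j.+1); rewrite /= (ltn_ord j) => /(_ isT).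
  by rewrite ler_distl => /andP[].
have -> : col j E = what j.+1
    - (q j.+1 + (if (0 < j)%N then (- theta j.+1 / rho j) *: what j else 0)).
  rewrite linearB /= col_Qmx col_Qmx_Rhat; case: ifP => _.
    by rewrite mulNr scaleNr; apply/colP => i; rewrite !mxE; ring.
  by rewrite !addr0.
case: j qj => [[|j] jk] /= qj.
  rewrite !addr0; apply: (le_trans (fl_vector_err ubar0 w1)).
  by rewrite ler_wpM2l.
apply: (le_trans (fl_axpy_err ubar0 (wS j.+1 jk))).
rewrite lerD ?ler_wpM2l // -mulrA ler_wpM2l //.
  by rewrite subr_ge0 exprn_ege1 // lerDl.
rewrite /cond2 -mulrA [_ * T]mulrC ler_pM ?norm2_ge0 ?what_le ?(ltnW jk) //.
have := entry_le_mxnorm2 Rhat (Ordinal (ltnW jk)) (Ordinal jk).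
rewrite mxE -val_eqE /= eqxx gtn_eqF // mulNr normrN; exact.
Qed.

(** Here [T = 1 + a + mxnorm2 E] contains the quantity being bounded; it is
    multiplied by a quantity of order [ubar], so that it can be absorbed. *)
Lemma E_le : mxnorm2 E <= Num.sqrt k%:R * (ubar * (1 + a))
  + Num.sqrt k.-1%:R * (((1 + ubar) ^+ 3 - 1) * (cond2 Rhat * T)).
Proof.
have g0 : 0 <= (1 + ubar) ^+ 3 - 1 by rewrite subr_ge0 exprn_ege1 // lerDl.
have T0 : 0 <= T by rewrite !addr_ge0 ?mxnorm2_ge0.
have k0 : 0 <= cond2 Rhat by rewrite mulr_ge0 ?mxnorm2_ge0.
apply: mxnorm2_le => [|v].
  by rewrite addr_ge0 ?mulr_ge0 ?sqrtr_ge0 ?mxnorm2_ge0 // addr_ge0.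
have -> : k.-1 = #|[pred j : 'I_k | (0 < j)%N]|.
  case: {+}k => [|k']; first by apply/esym/eq_card0 => -[].
  rewrite -[in LHS](card_ord k'.+1) -(cardC1 ord0); apply: eq_card => j.
  by rewrite !inE -val_eqE /= lt0n.
apply: norm2_mulmx_col_split col_E_le; apply: mulr_ge0 => //.
  exact: addr_ge0.
exact: mulr_ge0.
Qed.

(** The vector [g] is [Rhat^-1 y].  Measuring the error against [norm2 g] keeps
    [kappa] away from the [E g] term apart from what [E] itself contributes. *)
Lemma xhat_err : exists2 g : 'cV[R]_k,
  (1 - a) * norm2 g <= norm2 (x_exact rho theta phi q k) &
  norm2 (xhat k - x_exact rho theta phi q k) <=
  (mxnorm2 E + ((1 + ubar) ^+ k.+2 - 1) * (Num.sqrt k%:R * (cond2 Rhat * T)))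
  * norm2 g.
Proof.
have RU : Rhat \in unitmx by exact: Rhat_unit.
pose g := invmx Rhat *m y.
have yE : y = Rhat *m g by rewrite mulKVmx.
have xE : x_exact rho theta phi q k = Qmx k q *m g.
  by rewrite x_exact_Qmx -/y yE mulmxA w_exact_Rhat.
have T0 : 0 <= T by rewrite !addr_ge0 ?mxnorm2_ge0.
exists g; first by rewrite xE norm2_Qmx_ge.
have -> : xhat k - x_exact rho theta phi q k
    = E *m g + (xhat k - Qmx k what *m y).
  by rewrite xE yE mulmxBl -mulmxA; apply/colP => i; rewrite !mxE; ring.
apply: (le_trans (norm2_triangle _ _)); rewrite mulrDl lerD ?norm2_mulmx //.
have G0 : 0 <= (1 + ubar) ^+ k.+2 - 1.
  by rewrite subr_ge0 exprn_ege1 // lerDl.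
have [_ _ x0 xS] := upd.
apply: (@le_trans _ _ (((1 + ubar) ^+ k.+2 - 1)
    * (Num.sqrt k%:R * (T * mxnorm2 (invmx Rhat)) * norm2 y))).
  apply: (@norm2_le_abs_mulmx _ _ _ _ (Qmx k what)) => // [|i|j].
  - by rewrite mulr_ge0 ?mxnorm2_ge0.
  - have -> : (xhat k - Qmx k what *m y) i 0 = xhat k i 0
        - \sum_(j < k) phi j.+1 / rho j.+1 * what j.+1 i 0.
      rewrite !mxE; congr (_ - _).
      by apply: eq_bigr => j _; rewrite !mxE mulrC.
    under [in leRHS]eq_bigr do rewrite !mxE.
    by apply: (fl_linear_comb ubar0 x0 xS).
  - by rewrite col_Qmx what_le.
have yg : norm2 y <= mxnorm2 Rhat * norm2 g by rewrite yE norm2_mulmx.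
set G := (1 + ubar) ^+ k.+2 - 1 in G0 *.
have -> : G * (Num.sqrt k%:R * (cond2 Rhat * T)) * norm2 g
    = G * (Num.sqrt k%:R * (T * mxnorm2 (invmx Rhat))
           * (mxnorm2 Rhat * norm2 g)) by rewrite /cond2; ring.
do 2!apply: ler_wpM2l => //.
by rewrite mulr_ge0 ?sqrtr_ge0 // mulr_ge0 ?mxnorm2_ge0.
Qed.

End Perturbation.

(** * First-order terms *)

Section FirstOrder.
Variable R : realType.

(** The scalar side of the argument: [F] stands for [mxnorm2 E], [ng] for the
    norm of [Rhat^-1 y], [nx] and [err] for the norms of the exact iterate and
    of its error.  The two smallness conditions on [ubar] serve to absorb [F] into
    the left-hand side of its own bound, and then to get [F <= 1]. *)
Lemma first_order_bound (r r1 kappa N gN a ubar F T g3 gk ng nx err : R) :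
  0 <= r -> 0 <= r1 -> 0 <= kappa -> 0 <= N -> 0 <= gN ->
  0 <= a -> a <= 2^-1 -> 0 <= ubar -> ubar <= 1 -> 0 <= F -> 0 <= ng ->
  14 * (r1 * kappa) * ubar <= 1 ->
  (4 * r + 28 * (r1 * kappa)) * ubar <= 1 ->
  g3 <= 3 * ubar + 4 * ubar ^+ 2 ->
  gk <= N * ubar + gN * ubar ^+ 2 ->
  T = 1 + a + F ->
  F <= r * (ubar * (1 + a)) + r1 * (g3 * (kappa * T)) ->
  err <= (F + gk * (r * (kappa * T))) * ng ->
  (1 - a) * ng <= nx ->
  let S := 3 * r1 + N * r in
  err <= ((r + S * kappa) * ubar
          + (4 * r + 4 * (kappa * S)) * (a * ubar)
          + (2 * (4 * r + 28 * (r1 * kappa)) * (kappa * S)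
             + 5 * (kappa * (4 * r1 + gN * r))) * ubar ^+ 2) * nx.
Proof.
move=> r0 r10 k0 N0 gN0 a0 a1 u0 u1 F0 ng0 u14 uK g3u gku TE FE errE xE.
cbv zeta; set S := 3 * r1 + N * r.
set K := 4 * r + 28 * (r1 * kappa) in uK *.
have T0 : 0 <= T by rewrite TE; lra.
have rk0 : 0 <= r1 * kappa by rewrite mulr_ge0.
have S0 : 0 <= S by rewrite addr_ge0 // ?mulr_ge0.
have kS0 : 0 <= kappa * S by rewrite mulr_ge0.
set S' := 4 * r1 + gN * r.
have kS'0 : 0 <= kappa * S' by rewrite mulr_ge0 // addr_ge0 // mulr_ge0.
have kT0 : 0 <= kappa * T by rewrite mulr_ge0.
have uu : ubar ^+ 2 <= ubar by rewrite expr2 ler_piMr.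
have ru0 : 0 <= r * ubar by rewrite mulr_ge0.
have Fg : F <= r * ubar * (1 + a)
    + (r1 * kappa * T) * (3 * ubar + 4 * ubar ^+ 2).
  apply: (le_trans FE); rewrite -mulrA lerD2l.
  have -> : r1 * (g3 * (kappa * T)) = (r1 * kappa * T) * g3 by ring.
  by rewrite ler_wpM2l // mulr_ge0.
have FK : F <= K * ubar.
  (* as T <= 2 + F, the term 7 r1 kappa ubar F is at most F / 2 *)
  have h1 : r * ubar * a <= r * ubar by rewrite ler_piMr //; lra.
  have h2 : (r1 * kappa * T) * (3 * ubar + 4 * ubar ^+ 2)
      <= (r1 * kappa * T) * (7 * ubar).
    by rewrite ler_wpM2l ?mulr_ge0 //; lra.
  have h3 : r1 * kappa * ubar * T <= r1 * kappa * ubar * (2 + F).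
    by rewrite ler_wpM2l ?mulr_ge0 // TE; lra.
  have h4 : 14 * (r1 * kappa) * ubar * F <= 1 * F by rewrite ler_wpM2r.
  rewrite /K; lra.
have F1 : F <= 1 by apply: le_trans uK.
have B0 : 0 <= r * ubar * (1 + a) + kappa * T * (S * ubar + S' * ubar ^+ 2).
  rewrite addr_ge0 // mulr_ge0 //; first by rewrite addr_ge0.
  by rewrite addr_ge0 // mulr_ge0 ?sqr_ge0 // addr_ge0 // mulr_ge0.
have Bg : F + gk * (r * (kappa * T))
    <= r * ubar * (1 + a) + kappa * T * (S * ubar + S' * ubar ^+ 2).
  have : (r * (kappa * T)) * gk
      <= (r * (kappa * T)) * (N * ubar + gN * ubar ^+ 2).
    by rewrite ler_wpM2l // mulr_ge0.
  move: Fg; rewrite /S /S'; lra.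
(* (1 + 2 a)(1 - a) >= 1 for a <= 1/2 *)
have ngx : ng <= (1 + 2 * a) * nx.
  have : (1 + 2 * a) * ((1 - a) * ng) <= (1 + 2 * a) * nx.
    by rewrite ler_wpM2l //; lra.
  apply: le_trans; rewrite mulrA ler_peMl //.
  have : a * a <= a * 2^-1 by rewrite ler_wpM2l.
  lra.
have nx0 : 0 <= nx.
  by apply: le_trans xE; rewrite mulr_ge0 //; lra.
apply: (le_trans errE); apply: (le_trans (ler_wpM2r ng0 Bg)).
apply: (le_trans (ler_wpM2l B0 ngx)); rewrite [leLHS]mulrA ler_wpM2r //.
have aa : a * a <= a * 2^-1 by rewrite ler_wpM2l.
have aF : a * F <= 2^-1 * F by rewrite ler_wpM2r.
have T4 : T * (1 + 2 * a) <= 1 + 4 * a + 2 * (K * ubar) by rewrite TE; lra.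
have T5 : T * (1 + 2 * a) <= 5 by rewrite TE; lra.
have h1 : kappa * S * ubar * (T * (1 + 2 * a))
    <= kappa * S * ubar * (1 + 4 * a + 2 * (K * ubar)).
  by rewrite ler_wpM2l // mulr_ge0.
have h2 : kappa * S' * ubar ^+ 2 * (T * (1 + 2 * a))
    <= kappa * S' * ubar ^+ 2 * 5.
  by rewrite ler_wpM2l // mulr_ge0 // sqr_ge0.
have h3 : r * ubar * ((1 + a) * (1 + 2 * a)) <= r * ubar * (1 + 4 * a).
  by rewrite ler_wpM2l //; lra.
lra.
Qed.

(** Since [r ^+ 2 = k], this amounts to [3 * sqrt (k-1) <= 2 * k], true because
    [2 t ^+ 2 - 3 t + 2] has negative discriminant. *)
Lemma sqrt_count_le (k : nat) : (0 < k)%N ->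
  let r : R := Num.sqrt k%:R in
  3 * Num.sqrt k.-1%:R + k.+2%:R * r <= r * (2 + 2 * r + k%:R).
Proof.
case: k => // k _; cbv zeta; rewrite succnK.
set r := Num.sqrt k.+1%:R; set r1 := Num.sqrt k%:R.
have rr : r ^+ 2 = k.+1%:R by rewrite sqr_sqrtr ?ler0n.
have r1r1 : r1 ^+ 2 = k%:R by rewrite sqr_sqrtr ?ler0n.
(* completing the square in 2 t ^+ 2 - 3 t + 2 at t = r1 *)
have := sqr_ge0 (r1 - 3 / 4).
have -> : k.+3%:R = 3 + k%:R :> R by rewrite -addn3 natrD addrC.
have : k.+1%:R = 1 + k%:R :> R by rewrite -addn1 natrD addrC.
rewrite -rr -r1r1 => h; rewrite h.
have : r * r ^+ 2 = r * (1 + r1 ^+ 2) by rewrite h.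
nra.
Qed.

End FirstOrder.

(** * The error bound *)

(* The hidden constant C and the threshold delta of the O-term depend only on
   the data (A, b), k, the matrix Rhat_k and the constant c hidden in the O(u)
   properties of LBFRO. *)
Theorem theorem4p1 (R : realType) (m n : nat) (hmn : (n <= m)%N)
    (A : 'M[R]_(m, n)) (b : 'cV[R]_m) (k : nat) (hk : (0 < k)%N)
    (Rhat : 'M[R]_k) (c : R) :
  exists C delta : R, 0 < delta /\
  forall (u ubar : R)
    (alpha beta : nat -> R) (p : nat -> 'cV[R]_m) (q : nat -> 'cV[R]_n)
    (rho theta phi : nat -> R) (what xhat : nat -> 'cV[R]_n),
  0 < u <= delta -> 0 < ubar <= delta ->
  LBFRO A b k (c * u) alpha beta p q ->
  nonterminating k alpha beta ->
  near_orthonormal k (c * u) q ->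
  normalized k (c * u) q ->
  givens_double k alpha beta rho theta phi ->
  Rhat_mx k rho theta = Rhat ->
  rounded_updates k ubar rho theta phi q what xhat ->
  norm2 (xhat k - x_exact rho theta phi q k)
    / norm2 (x_exact rho theta phi q k)
  <= Num.sqrt k%:R
       * (1 + (2 + 2 * Num.sqrt k%:R + k%:R) * cond2 Rhat) * ubar
     + C * (ubar ^+ 2 + ubar * u).
Proof.
set kappa := cond2 Rhat.
have kappa0 : 0 <= kappa by rewrite mulr_ge0 ?mxnorm2_ge0.
have [g g0 gP] := expr1D_le R k.+2.
set r := Num.sqrt k%:R; set r1 : R := Num.sqrt k.-1%:R.
have r0 : 0 <= r by exact: sqrtr_ge0.
have r10 : 0 <= r1 by exact: sqrtr_ge0.
set S := 3 * r1 + k.+2%:R * r.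
have rN0 : 0 <= k.+2%:R * r by exact: mulr_ge0.
have S0 : 0 <= S by rewrite /S; lra.
have kS0 : 0 <= kappa * S by exact: mulr_ge0.
set K := 4 * r + 28 * (r1 * kappa).
have rk0 : 0 <= r1 * kappa by rewrite mulr_ge0.
have K0 : 0 <= K by rewrite /K; lra.
(* delta = 1 / D: each summand of D secures one smallness condition *)
set D := 1 + 2 * `|c| + 14 * (r1 * kappa) + K.
set C1 := 4 * r + 4 * (kappa * S).
set C2 := 2 * K * (kappa * S) + 5 * (kappa * (4 * r1 + g * r)).
have C10 : 0 <= C1 by rewrite /C1; lra.
have C20 : 0 <= C2.
  have KS0 : 0 <= K * (kappa * S) by exact: mulr_ge0.
  have gr0 : 0 <= g * r by exact: mulr_ge0.
  have kr0 : 0 <= kappa * (4 * r1 + g * r) by apply: mulr_ge0 => //; lra.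
  rewrite /C2; lra.
have c0 := normr_ge0 c.
have D0 : 0 < D by rewrite /D; lra.
exists (C1 * `|c| + C2), D^-1; split; first by rewrite invr_gt0.
move=> u ubar alpha beta p q rho theta phi what xhat /andP[u0 ud] /andP[v0 vd].
move=> _ _ Qo qn _ RE upd.
have le_inv x y : 0 < x -> x <= D^-1 -> 0 <= y -> y <= D -> y * x <= 1.
  by move=> x0 xD y0 yD; rewrite -(divff (lt0r_neq0 D0)) ler_pM // ltW.
(* the absolute value makes a nonnegative whatever the sign of c *)
pose a := `|c| * u.
have cua : c * u <= a by rewrite ler_wpM2r ?ler_norm // ltW.
have a0 : 0 <= a by rewrite mulr_ge0 // ltW.
have a1 : a <= 2^-1.
  have : 2 * `|c| * u <= 1 by apply: le_inv => //; rewrite /D; lra.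
  by rewrite /a; lra.
have v1 : ubar <= 1.
  by rewrite -[ubar]mul1r; apply: le_inv => //; rewrite /D; lra.
have v14 : 14 * (r1 * kappa) * ubar <= 1.
  by apply: le_inv => //; rewrite /D; lra.
have vK : K * ubar <= 1 by apply: le_inv => //; rewrite /D; lra.
have Qa : near_orthonormal k a q.
  by case: Qo => P PP QP; exists P => //; apply: le_trans cua.
have qa : normalized k a q by move=> i ik; apply: le_trans cua; exact: qn.
have v0' := ltW v0.
have [y xE errE] := xhat_err v0' a0 Qa upd.
have FE := E_le v0' a0 Qa qa upd.
rewrite RE in FE errE.
set x := x_exact _ _ _ _ _ in xE errE *.
set err := norm2 (xhat k - x) in errE *.
have g3 : (1 + ubar) ^+ 3 - 1 <= 3 * ubar + 4 * ubar ^+ 2.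
  have : ubar ^+ 2 * ubar <= ubar ^+ 2 by rewrite ler_piMr ?sqr_ge0.
  lra.
have gk : (1 + ubar) ^+ k.+2 - 1 <= k.+2%:R * ubar + g * ubar ^+ 2.
  by apply: gP; rewrite v0'.
have := first_order_bound r0 r10 kappa0 (ler0n _ k.+2) g0 a0 a1 v0' v1
  (mxnorm2_ge0 _) (norm2_ge0 _) v14 vK g3 gk erefl FE errE xE.
rewrite -/S -/K -/C1 -/C2 /= => bnd.
have Sr := sqrt_count_le R hk; rewrite /= -/r -/r1 -/S in Sr.
have Srk : S * kappa * ubar <= r * (2 + 2 * r + k%:R) * kappa * ubar.
  by rewrite !ler_wpM2r.
have vu0 : 0 <= ubar * u by rewrite mulr_ge0 // ltW.
have v20 := sqr_ge0 ubar.
set rhs := (X in _ <= X).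
have rhsP : (r + S * kappa) * ubar + C1 * (a * ubar) + C2 * ubar ^+ 2 <= rhs.
  have h1 : 0 <= C1 * `|c| * ubar ^+ 2 by rewrite !mulr_ge0.
  have h2 : 0 <= C2 * (ubar * u) by rewrite mulr_ge0.
  rewrite /rhs /a; lra.
have rhs0 : 0 <= rhs.
  apply: le_trans rhsP; apply: addr_ge0; last exact: mulr_ge0.
  apply: addr_ge0; last by apply: mulr_ge0 => //; exact: mulr_ge0.
  by apply: mulr_ge0 => //; apply: addr_ge0 => //; exact: mulr_ge0.
have [->|x0] := eqVneq (norm2 x) 0; first by rewrite invr0 mulr0.
have xp : 0 < norm2 x by rewrite lt_def x0 norm2_ge0.
by rewrite ler_pdivrMr // (le_trans bnd) // ler_wpM2r // ltW.
Qed.
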